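(* Let $h \ge 2$ be an integer with prime power factorization $h=q_1q_2\cdots q_{\omega(h)}$ (the $q_i$ powers of distinct primes), and let $k\ge 2$ be an integer. For integers $k'\ge 2$ put $\lambda(h,k'):=\prod_{i=1}^{\omega(h)} q_i^{d_i-1}$ with $d_i=\lceil \log_{q_i} k'\rceil$. Then there exists an HTD$(k,h^q)$ for all prime powers $q\equiv 1\pmod{\lambda(h,k)}$ with $q>\lambda(h,k)^{k(k-1)}$. Equivalently, $N(h^q) \ge k$ for all prime powers $q\equiv 1 \pmod{\lambda(h,k+2)}$ with $q>\lambda(h,k+2)^{(k+2)(k+1)}$.
   Context: $\omega(h)$ is the number of distinct prime factors of $h$. A holey transversal design HTD$(k,h^n)$ consists of the point set $[k]\times X$, where $|X|=hn$ and $X$ is equipped with a partition into $n$ holes each of size $h$, together with a collection of $k$-element blocks such that every pair of points $(i,x),(j,y)$ with $i\ne j$ and $x,y$ in different holes lies in exactly one block, and no block contains two points $(i,x),(j,y)$ with $i=j$, or with $x,y$ in the same hole. A holey latin square of type $h^n$ is an $hn\times hn$ array with rows, columns and symbols indexed by $[hn]$, together with a partition of $[hn]$ into $n$ holes $H_1,\dots,H_n$ of size $h$, such that cell $(i,j)$ is empty iff $(i,j)\in\bigcup_k H_k\times H_k$ and otherwise contains one symbol, each row/column contains each symbol at most once, and symbols of $H_k$ do not appear in rows or columns indexed by $H_k$. Two such squares with the same holes are orthogonal if, superimposed, every ordered pair of symbols from different holes appears exactly once. $N(h^n)$ is the maximum number of pairwise orthogonal holey latin squares of type $h^n$ (HMOLS)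 with a common hole partition; the existence of $k-2$ HMOLS of type $h^n$ is equivalent to the existence of an HTD$(k,h^n)$.
   Formalization: When λ(h,k)=1 the formal statement also requires q ≥ k (and q ≥ k+2 when λ(h,k+2)=1 in the second part); without this the claim fails, e.g. h=k=3, q=2, since the k points of a block lie in k distinct holes. *)

(* Defs.v *)
From mathcomp Require Import all_boot all_algebra.

Set Implicit Arguments.
Unset Strict Implicit.
Unset Printing Implicit Defensive.

Definition prime_power (q : nat) : Prop :=
  exists p e : nat, [/\ prime p, 0 < e & q = p ^ e].

(* The prime power factors of h are the h`_p = p ^ logn p h for p prime
   dividing h, and up_log b k is the ceiling of the base-b logarithm of k. *)
Definition lambda (h k : nat) : nat :=
  \prod_(p <- primes h) h`_p ^ (up_log h`_p k).-1.

Definition hole_partition (h n : nat) (X : finType) (H : {set {set X}}) : bool :=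
  [&& partition H [set: X], #|H| == n & [forall A in H, #|A| == h]].

Definition same_hole (X : finType) (H : {set {set X}}) (x y : X) : bool :=
  [exists A in H, (x \in A) && (y \in A)].

(* For k >= 2, two equal blocks would cover some pair of points twice, so a
   set of blocks loses no generality over a multiset. *)
Definition is_HTD (k h n : nat) (X : finType) (H : {set {set X}})
    (B : {set {set 'I_k * X}}) : Prop :=
  [/\ #|X| = h * n,
      hole_partition h n H,
      forall b, b \in B -> #|b| = k,
      forall (i j : 'I_k) (x y : X), i != j -> ~~ same_hole H x y ->
        #|[set b in B | ((i, x) \in b) && ((j, y) \in b)]| = 1
    & forall b, b \in B -> forall u v : 'I_k * X, u \in b -> v \in b ->
        u != v -> ~ (u.1 = v.1 \/ same_hole H u.2 v.2)].

Definition HTD_exists (k h n : nat) : Prop :=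
  exists (X : finType) (H : {set {set X}}) (B : {set {set 'I_k * X}}),
    is_HTD h n H B.

(* None is the empty cell. *)
Notation square m := 'M[option 'I_m]_m.

Definition holey_latin (m : nat) (H : {set {set 'I_m}}) (L : square m) : bool :=
  [&& [forall i, forall j, (L i j == None) == same_hole H i j],
      [forall i, forall s, #|[set j | L i j == Some s]| <= 1],
      [forall j, forall s, #|[set i | L i j == Some s]| <= 1]
    & [forall i, forall j, forall s, (L i j == Some s) ==>
        (~~ same_hole H s i && ~~ same_hole H s j)]].

Definition orthogonal_holey (m : nat) (H : {set {set 'I_m}})
    (L M : square m) : bool :=
  [forall s, forall t, ~~ same_hole H s t ==>
    (#|[set c : 'I_m * 'I_m |
         (L c.1 c.2 == Some s) && (M c.1 c.2 == Some t)]| == 1)].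

Definition is_HMOLS (h n : nat) (H : {set {set 'I_(h * n)}})
    (S : {set square (h * n)}) : bool :=
  [&& hole_partition h n H,
      [forall L in S, holey_latin H L]
    & [forall L in S, forall M in S, (L != M) ==> orthogonal_holey H L M]].

(* A set of squares, not a family: distinct squares are what is counted. For
   h > 0 and n > 1 no square is orthogonal to itself, so the sizes agree. *)
Definition N_HMOLS (h n : nat) : nat :=
  \max_(S : {set square (h * n)} | [exists H, is_HMOLS H S]) #|S|.

(* The points of a block lie in k distinct holes. When lambda h k = 1 the bound
   lambda h k ^ (k * (k - 1)) < q only says 1 < q, so k <= q must be required
   separately: for instance lambda 3 3 = 1 and there is no HTD(3, 3^2). When
   1 < lambda h k, the bound already gives k < q. *)
Lemma HTD_exists_leq (k h n : nat) :
  1 < k -> 0 < h -> 1 < n -> HTD_exists k h n -> k <= n.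
Proof.
move=> k1 h0 n1 [X [H [B [_ /and3P[pH /eqP nH /forall_inP hH] kB cB dB]]]].
have sh x y : same_hole H x y = (pblock H x == pblock H y).
  have xc z : z \in cover H by rewrite (cover_partition pH) inE.
  apply/exists_inP/eqP => [[A AH /andP[xA yA]]|e].
    by rewrite !(def_pblock (partition_trivIset pH) AH).
  by exists (pblock H x); rewrite ?pblock_mem // mem_pblock xc e mem_pblock xc.
have /card_gt1P [A [C [AH CH AC]]] : 1 < #|H| by rewrite nH.
have /card_gt0P [x xA] : 0 < #|A| by rewrite (eqP (hH _ AH)).
have /card_gt0P [y yC] : 0 < #|C| by rewrite (eqP (hH _ CH)).
have nxy : ~~ same_hole H x y.
  by rewrite sh !(def_pblock (partition_trivIset pH) AH xA,
    def_pblock (partition_trivIset pH) CH yC).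
have := cB (Ordinal (ltnW k1)) (Ordinal k1) x y isT nxy.
move=> c1; have /card_gt0P [b] : 0 < #|[set b in B | ((Ordinal (ltnW k1), x) \in b)
  && ((Ordinal k1, y) \in b)]| by rewrite c1.
rewrite inE => /andP[bB _].
rewrite -(kB _ bB) -nH -(card_in_imset (f := fun u : 'I_k * X => pblock H u.2)).
  apply/subset_leq_card/subsetP => _ /imsetP[u _ ->].
  by rewrite pblock_mem // (cover_partition pH) inE.
move=> u v ub vb /= e; apply/eqP/negP => /negP uv.
by apply: (dB _ bB _ _ ub vb uv); right; rewrite sh e.
Qed.

(* Main.v *)
Require Import Defs.
From HB Require Import structures.
From mathcomp Require Import all_boot all_order all_algebra all_field zify ring.

(* Let e = lambda h k. Projecting the multiplication table of GF(q_i^d_i) onto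
   GF(q_i) and multiplying over i gives a difference matrix (D_ic) with k rows
   over a group G of order h in which every difference occurs e times. Write
   q - 1 = e f and F = GF(q). For each column c choose x_c in F^k such that, for
   i <> j, the e columns with the same D_ic - D_jc have x_ci - x_cj in the e
   different cyclotomic classes of index e. The blocks
   {(i, (D_ic + g, u x_ci + y)) : i < k}, with u^f = 1, then form the HTD on
   G x F.
   The x_c exist by Wilson's second moment argument. For A in F, the squared
   deviations from #|A|/e of the number of elements of A in the translate
   x + K, summed over x and over all classes K, have a closed form, since
   (y - x)^f = (z - x)^f has about f solutions x. So few x are bad for a given
   class, and the coordinates of x_c can be chosen one by one. *)

Set Implicit Arguments.
Unset Strict Implicit.
Unset Printing Implicit Defensive.

Import GRing.Theory.

(** * Difference matrices over groups of order h *)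

Definition difference_matrix (k l : nat) (G : finZmodType) (C : finType)
    (D : 'I_k -> C -> G) : Prop :=
  forall i j, i != j -> forall g, #|[set c | (D i c - D j c)%R == g]| = l.

Definition difference_matrix_exists (k h l : nat) : Prop :=
  exists (G : finZmodType) (C : finType) (D : 'I_k -> C -> G),
    #|G| = h /\ difference_matrix l D.

(** Declared over [finZmodType] so that a product of finite abelian groups is inferred to be one
    again. *)
HB.instance Definition _ (G1 G2 : finZmodType) :=
  GRing.Zmodule.on (G1 * G2)%type.

Lemma difference_matrix_exists1 (k : nat) : difference_matrix_exists k 1 1.
Proof.
exists 'rV['F_2]_0, unit, (fun _ _ => 0%R); split.
  by rewrite card_mx.
move=> i j _ g; rewrite -[RHS]card_unit -cardsT; apply: eq_card => c.
by rewrite !inE [g]thinmx0 subr0 eqxx.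
Qed.

Lemma difference_matrix_existsM (k h1 l1 h2 l2 : nat) :
  difference_matrix_exists k h1 l1 -> difference_matrix_exists k h2 l2 ->
  difference_matrix_exists k (h1 * h2) (l1 * l2).
Proof.
move=> [G1 [C1 [D1 [<- dm1]]]] [G2 [C2 [D2 [<- dm2]]]].
exists (G1 * G2)%type, (C1 * C2)%type, (fun i c => (D1 i c.1, D2 i c.2)).
split=> [|i j ij [g1 g2]]; first by rewrite card_prod.
rewrite -(dm1 i j ij g1) -(dm2 i j ij g2) -cardsX.
by apply: eq_card => c; rewrite !inE.
Qed.

Lemma card_lsubmx_fiber (R : finNzRingType) (a b : nat) (u : 'rV[R]_a) :
  #|[set v : 'rV[R]_(a + b) | lsubmx v == u]| = #|R| ^ b.
Proof.
have <- : #|'rV[R]_b| = #|R| ^ b by rewrite card_mx mul1n.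
have row_inj : injective (row_mx u : 'rV[R]_b -> _).
  exact: can_inj (row_mxKr u).
rewrite -cardsT -(card_imset _ row_inj).
apply: eq_card => v; rewrite inE; apply/eqP/imsetP => [<-|[w _ ->]].
  by exists (rsubmx v); rewrite ?hsubmxK ?inE.
by rewrite row_mxKl.
Qed.

(** With q = p ^ a, the rows are labelled by distinct elements e_i of the field of order q ^ d, and
    the entry in column x is an F_p-linear projection of e_i x. A difference of two rows is this
    projection after the bijection multiplying by e_i - e_j, so all its fibres have the size of the
    kernel. *)
Lemma difference_matrix_exists_pfactor (k p a d : nat) :
  prime p -> 0 < a -> 0 < d -> k <= (p ^ a) ^ d ->
  difference_matrix_exists k (p ^ a) ((p ^ a) ^ d.-1).
Proof.
case: d => // d pp a0 _ kq.
have [F pF cF] := pPrimePowerField pp (leq_trans a0 (leq_pmulr a (ltn0Sn d))).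
have [v2r lin_v2r bij_v2r] := pprimeChar_vectAxiom pF.
(* The dimension is put in the form [a + a * d], so that [lsubmx] keeps the first [a] coordinates
   and its fibres have p ^ (a * d) elements. *)
rewrite cF pfactorK // mulnS in v2r lin_v2r bij_v2r.
have leF : k <= #|F| by rewrite cF expnM.
pose e (i : 'I_k) : F := enum_val (widen_ord leF i).
have e_inj : injective e by move=> i j /enum_val_inj /(congr1 val) /= /val_inj.
exists 'rV['F_p]_a, F, (fun i x => lsubmx (v2r (e i * x)%R)); split.
  by rewrite card_mx card_Fp // mul1n.
move=> i j ij u.
have lin_B x y : (v2r x - v2r y = v2r (x - y))%R.
  apply/esym; have /= := lin_v2r (-1)%R y x.
  rewrite !scaleN1r [RHS]addrC => <-; congr v2r.
  by rewrite addrC.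
have nz : (e i - e j)%R != 0%R by rewrite subr_eq0 (inj_eq e_inj).
have bij_f : bijective (fun x : F => v2r ((e i - e j) * x)%R).
  apply: bij_comp bij_v2r _.
  by exists (fun x : F => (e i - e j)^-1 * x)%R => x; rewrite ?mulKf ?mulVKf.
rewrite -expnM -[in RHS](card_Fp pp) -(card_lsubmx_fiber _ u).
rewrite -[RHS](on_card_preimset (f := fun x : F => v2r ((e i - e j) * x)%R)).
  apply: eq_card => x; rewrite !inE -linearB /= lin_B -mulrBl.
  by [].
exact: onW_bij.
Qed.

(** The matrices for the prime power factors q of h are multiplied together. The exponent d given by
    [up_log] ensures k <= q ^ d, so that the field of order q ^ d has k distinct row labels. *)
Lemma difference_matrix_exists_lambda (h k : nat) :
  0 < h -> 1 < k -> difference_matrix_exists k h (lambda h k).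
Proof.
move=> h0 k1; have hE : h = \prod_(p <- primes h) h`_p.
  rewrite [LHS]prod_prime_decomp // prime_decompE big_map.
  by apply: eq_bigr => p _; rewrite /= p_part.
rewrite {1}hE /lambda big_seq [X in difference_matrix_exists k _ X]big_seq.
elim/big_rec2: _ => [|p l g ph IH]; first exact: difference_matrix_exists1.
apply: difference_matrix_existsM IH.
have [pp _ _] := and3P (etrans (esym (mem_primes p h)) ph).
have a0 : 0 < logn p h by rewrite logn_gt0.
have q1 : 1 < p ^ logn p h.
  by rewrite -(exp1n (logn p h)) ltn_exp2r // prime_gt1.
rewrite p_part; apply: difference_matrix_exists_pfactor => //.
  by rewrite up_log_gt0 q1.
exact: up_logP.
Qed.

(** * Cyclotomic classes as fibres of a power map *)

Lemma leq_card_power_fiber (R : finIdomainType) (n : nat) (c : R) :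
  0 < n -> #|[set x : R | (x ^+ n)%R == c]| <= n.
Proof.
move=> n0; rewrite cardE -ltnS -(size_XnsubC c n0).
apply: max_poly_roots; rewrite ?enum_uniq //.
  by rewrite -size_poly_gt0 size_XnsubC.
apply/allP => x; rewrite mem_enum inE => /eqP xc.
by rewrite /root !hornerE xc subrr.
Qed.

Lemma expf_pred_card (F : finFieldType) (x : F) :
  x != 0%R -> (x ^+ #|F|.-1 = 1)%R.
Proof.
move=> x0; apply: (mulfI x0).
by rewrite -exprS prednK ?expf_card ?mulr1 // ltnW // finNzRing_gt1.
Qed.

(* The cyclotomic class of x <> 0 is encoded by x ^+ f, an e-th root of unity. *)
Lemma card_power_fiber_roots (F : finFieldType) (e f : nat) :
  e * f = #|F|.-1 ->
  #|[set w : F | (w ^+ e)%R == 1%R]| = e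
  /\ forall w : F, (w ^+ e = 1)%R -> #|[set x : F | (x ^+ f)%R == w]| = f.
Proof.
move=> ef; have F1 := finNzRing_gt1 F.
have [e0 f0] : 0 < e /\ 0 < f.
  by apply/andP; rewrite -muln_gt0 ef -subn1 subn_gt0.
set R := [set w | _].
have RN0 w : w \in R -> w != 0%R.
  rewrite inE; apply: contraTneq => ->.
  by rewrite expr0n gtn_eqF // eq_sym oner_eq0.
have sumE : \sum_(w in R) #|[set x : F | (x ^+ f)%R == w]| = e * f.
  rewrite ef -(cardC1 (0 : F)%R) -sum1_card.
  rewrite [RHS](partition_big (fun x : F => (x ^+ f)%R) (mem R)) => [|x x0] /=.
    apply: eq_bigr => w wR; rewrite sum1dep_card.
    apply: eq_card => x; rewrite !inE.
    case: eqP => [xw|]; rewrite ?andbF // andbT.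
    apply/esym; apply: contraTneq (RN0 _ wR) => x0.
    by rewrite -xw x0 expr0n gtn_eqF // eqxx.
  by rewrite inE -exprM mulnC ef expf_pred_card.
have leR : #|R| <= e by apply: leq_card_power_fiber.
(* There are at most e roots, each fibre has at most f elements, and the fibres total e * f; hence
   both bounds are equalities. [leqif_sum] keeps the equality case. *)
have lif := leqif_sum (P := mem R) (fun w _ =>
  leqif_eq (leq_card_power_fiber w f0)).
have sumf : \sum_(w in R) f = #|R| * f by rewrite sum_nat_const.
have [/= le1 eq1] := lif; rewrite sumE sumf in le1 eq1.
have eR : #|R| = e.
  by apply/eqP; rewrite eqn_leq leR -(leq_pmul2r f0).
split=> // w we; move: eq1; rewrite eR eqxx => /esym/forall_inP/(_ w).
by rewrite inE we eqxx => /(_ isT)/eqP.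
Qed.

(** * The second moment estimate *)

Lemma card_square_sum (T : finType) (A : {set T}) (P : pred T) :
  #|[set y in A | P y]| ^ 2 = \sum_(y in A) \sum_(z in A) (P y && P z).
Proof.
have cE : #|[set y in A | P y]| = \sum_(y in A) P y.
  rewrite -sum1_card [RHS]big_mkcond [LHS]big_mkcond; apply: eq_bigr => y _.
  by rewrite inE; case: (_ \in _); case: (P y).
rewrite -mulnn cE big_distrl; apply: eq_bigr => y _.
by rewrite big_distrr; apply: eq_bigr => z _; case: (P y); case: (P z).
Qed.

(** For y <> z the map x |-> (y - x) / (z - x) is injective and sends the set into the f-th roots of
    unity other than 1. For y = z only x = y is excluded. *)
Lemma card_same_power (F : finFieldType) (e f : nat) (y z : F) :
  e * f = #|F|.-1 ->
  #|[set x : F | [&& y - x != 0, z - x != 0 & (y - x) ^+ f == (z - x) ^+ f]%R]|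
    <= if y == z then #|F|.-1 else f.-1.
Proof.
move=> ef; set S := [set x | _].
have [yz|yz] := eqVneq y z.
  rewrite -(cardsC1 y); apply/subset_leq_card/subsetP => x.
  by rewrite !inE => /and3P[+ _ _]; rewrite subr_eq0 eq_sym.
have [_ cf] := card_power_fiber_roots ef.
have cf1 := cf 1%R (expr1n _ e).
rewrite -[f in f.-1]cf1 [in leqRHS](cardsD1 1%R) inE expr1n eqxx /=.
pose g (x : F) : F := ((y - x) / (z - x))%R.
have g_inj : {in S &, injective g}.
  move=> x x'; rewrite !inE /g => /and3P[_ zx _] /and3P[_ zx' _] /eqP.
  rewrite eqr_div // -subr_eq0.
  have -> : ((y - x) * (z - x') - (y - x') * (z - x) = (y - z) * (x - x'))%R.
    by ring.
  by rewrite mulf_eq0 !subr_eq0 (negPf yz) => /eqP.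
rewrite -(card_in_imset g_inj).
apply/subset_leq_card/subsetP => _ /imsetP[x xS ->].
move: xS; rewrite !inE /g => /and3P[yx zx /eqP fE].
rewrite expr_div_n fE divff ?expf_neq0 // eqxx andbT.
apply: contraNneq yz => /(canRL (mulfVK zx)); rewrite mul1r => /addIr ->.
exact: eqxx.
Qed.

(* Bounding the second moment for the single class [w] would need Jacobi sums;
   summed over all classes it is elementary, and the terms are nonnegative. *)
Lemma few_low_degree (F : finFieldType) (e f : nat) (A : {set F}) (w : F) :
  e * f = #|F|.-1 -> 1 < e -> (w ^+ e = 1)%R -> 0 < #|A| ->
  #|[set x | 2 * e * #|[set y in A | (y - x) ^+ f == w]%R| <= #|A|]| * #|A|
    < 4 * e ^ 2 * #|F|.-1.
Proof.
move=> ef e1 we a0; set B := [set x | _]; set a := #|A|.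
have [cR cf] := card_power_fiber_roots ef.
set R := [set _ | _] in cR.
pose N v x := #|[set y in A | (y - x) ^+ f == v]%R|.
have f0 : 0 < f.
  by have := finNzRing_gt1 F; rewrite -subn_gt0 subn1 -ef muln_gt0 => /andP[].
have S1 : \sum_(v in R) \sum_x N v x = e * (a * f).
  rewrite -cR -sum_nat_const; apply: eq_bigr => v; rewrite inE => /eqP ve.
  rewrite -sum_nat_const; under eq_bigr do rewrite /N -sum1dep_card.
  rewrite (exchange_big_dep (mem A)) /=; last by move=> x y _ /andP[].
  apply: eq_bigr => y yA; rewrite sum1dep_card.
  rewrite -[RHS](cf v ve) -[RHS](card_imset _ (can_inj (subKr y))).
  apply: eq_card => x; rewrite inE yA /=; apply/idP/imsetP => [xv|[z + ->]].
    by exists (y - x)%R; rewrite ?inE // subKr.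
  by rewrite inE subKr.
(* The square expands into pairs (y, z) of elements of [A]; the diagonal and the off-diagonal pairs
   are bounded by [card_same_power]. *)
have S2 : \sum_(v in R) \sum_x N v x ^ 2 <= a * #|F|.-1 + a * (a.-1 * f.-1).
  have -> : \sum_(v in R) \sum_x N v x ^ 2 = \sum_(y in A) \sum_(z in A)
      \sum_x \sum_(v in R) (((y - x) ^+ f == v) && ((z - x) ^+ f == v))%R.
    under eq_bigr do under eq_bigr do rewrite card_square_sum.
    rewrite exchange_big /=; under eq_bigr do rewrite exchange_big /=.
    rewrite exchange_big /=; apply: eq_bigr => y _.
    under eq_bigr do rewrite exchange_big /=.
    by rewrite exchange_big.
  rewrite -mulnDr -sum_nat_const; apply: leq_sum => y yA.
  have -> : #|F|.-1 + a.-1 * f.-1 =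
      \sum_(z in A) (if y == z then #|F|.-1 else f.-1).
    rewrite (bigD1 y) //= eqxx; congr (_ + _).
    rewrite /a (cardsD1 y) yA /= -sum_nat_const.
    apply: eq_big => [z|z]; first by rewrite !inE andbC.
    by rewrite !inE eq_sym => /andP[/negPf -> _].
  apply: leq_sum => z zA; apply: leq_trans (card_same_power y z ef).
  rewrite -sum1dep_card [leqRHS]big_mkcond; apply: leq_sum => x _.
  have Rn0 (u : F) : (u ^+ f)%R \in R -> u != 0%R.
    rewrite inE; apply: contraTneq => ->; rewrite expr0n gtn_eqF // expr0n.
    by rewrite gtn_eqF ?(ltnW e1) // eq_sym oner_eq0.
  case: ifPn => [_|nS].
    have [|nR] := boolP (((y - x) ^+ f)%R \in R).
      move=> yR; rewrite (bigD1 _ yR) /= eqxx big1 ?addn0.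
        by case: (_ == _).
      by move=> v /andP[_ /negPf]; rewrite eq_sym => ->.
    rewrite big1 // => v vR; case: eqP => // yv; first by rewrite yv vR in nR.
  rewrite big1 // => v vR; apply/eqP; rewrite eqb0; apply: contra nS.
  move=> /andP[/eqP yv /eqP zv]; rewrite yv zv eqxx !Rn0 ?yv ?zv //.
(* The square 4 * (e * N v x - a) ^ 2 is nonnegative, and at least a ^ 2 when v = w and x lies in
   [B]. Summing over v and x gives this inequality, written without subtraction. *)
have SB : #|B| * a ^ 2 + 8 * a * e * (e * (a * f)) <=
    4 * (e ^ 2 * (a * #|F|.-1 + a * (a.-1 * f.-1)) + e * #|F| * a ^ 2).
  have wR : w \in R by rewrite inE we eqxx.
  have -> : #|B| * a ^ 2 = \sum_(v in R) \sum_x ((v == w) && (x \in B)) * a ^ 2.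
    rewrite (bigD1 w) //= [X in _ + X]big1 ?addn0.
      rewrite -sum_nat_const big_mkcond; apply: eq_bigr => x _.
      by rewrite eqxx; case: (x \in B); rewrite ?mul1n.
    by move=> v /andP[_ /negPf ->]; rewrite big1.
  apply: (@leq_trans (4 * (e ^ 2 * (\sum_(v in R) \sum_x N v x ^ 2)
      + e * #|F| * a ^ 2)));
    last by rewrite leq_mul2l leq_add2r leq_mul2l S2 orbT.
  rewrite -S1 -[e in e * #|F|]cR.
  have -> : #|R| * #|F| * a ^ 2 = \sum_(v in R) \sum_(x : F) a ^ 2.
    by rewrite !sum_nat_const mulnA.
  rewrite !big_distrr -!big_split big_distrr; apply: leq_sum => v vR /=.
  rewrite !big_distrr -!big_split big_distrr; apply: leq_sum => x _ /=.
  have [/andP[/eqP-> ]|_] := boolP (_ && _); last first.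
    rewrite mul0n add0n -expnMn.
    have -> : 8 * a * e * N v x = 4 * (2 * (e * N v x * a)) by lia.
    by rewrite leq_mul2l nat_Cauchy.
  rewrite inE -/(N w x) -/a => lo.
  rewrite mul1n -expnMn.
  have -> : 8 * a * e * N w x = 8 * a * (e * N w x) by lia.
  by move: lo; rewrite -mulnA; move: (e * _) => m; nia.
have F1 : #|F| = e * f + 1 by rewrite ef addn1 prednK // ltnW // finNzRing_gt1.
move: SB; rewrite -ef F1 {S1 S2}; move: a0 f0 e1; rewrite -/a; clearbody a.
move: #|B| => b; case: a => // a; case: f {ef cf F1 N B} => // f _ _ e1 /=.
rewrite -![_ ^ 2]mulnn => le; rewrite -(ltn_pmul2r (ltn0Sn a)).
(* The terms of degree 2 in #|A| and 1 in f cancel. What is subtracted from the main term is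
   positive because 1 < e and [A] is nonempty, whence the strict bound. *)
apply: (leq_ltn_trans (n := 4 * (e * e) * (e * f.+1) * a.+1
   - 4 * e * (e.-1 * a.+1 * a.+1 + e * f * a.+1))); first by nia.
by rewrite ltn_subrL; nia.
Qed.

(** * Points whose differences lie in prescribed cyclotomic classes *)

(** Greedy choice, by induction on m. By [few_low_degree] the bad sets [B j] together have fewer
    elements than [A 0], so some x0 in [A 0] leaves in every later set more than a fraction 1 / (2
    e) of points in the required class relative to x0. These points form the sets of the next
    stage. *)
Lemma cyclotomic_embedding (F : finFieldType) (e f m : nat)
    (A : nat -> {set F}) (w : nat -> nat -> F) :
  e * f = #|F|.-1 -> 1 < e -> (forall i j, (w i j ^+ e = 1)%R) ->
  (forall i, i < m -> #|F|.-1 * e ^ (4 * m.-1) <= #|A i| ^ 2) ->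
  exists x : nat -> F, (forall i, i < m -> x i \in A i) /\
    (forall i j, i < j < m -> ((x j - x i) ^+ f = w i j)%R).
Proof.
move=> ef e1; elim: m A w => [|m IH] A w we leA.
  by exists (fun _ => 0%R); split=> // i j; rewrite ltn0 andbF.
have Q0 : 0 < #|F|.-1 by rewrite -subn1 subn_gt0 finNzRing_gt1.
have A0 i : i < m.+1 -> 0 < #|A i|.
  move/leA; apply: contraTltn; rewrite leqn0 => /eqP ->.
  by rewrite -ltnNge muln_gt0 Q0 expn_gt0 ltnW.
pose B (j : nat) := [set x |
  2 * e * #|[set y in A j.+1 | (y - x) ^+ f == w 0 j.+1]%R| <= #|A j.+1|].
have smallB j : j < m -> m * #|B j| < #|A 0|.
  move=> jm; have := few_low_degree ef e1 (we 0 j.+1) (A0 j.+1 jm).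
  rewrite -/(B j) => leB; have aj0 := A0 j.+1 jm.
  rewrite -(ltn_pmul2r aj0) -mulnA.
  have m0 : 0 < m by apply: leq_ltn_trans jm.
  (* The size bounds for the squares of #|A 0| and #|A j.+1| are multiplied, and a square root is
     taken. *)
  have le0 : #|F|.-1 * e ^ (4 * m) <= #|A 0| * #|A j.+1|.
    by rewrite -leq_sqr -[leqLHS]mulnn expnMn; apply: leq_mul; apply: leA.
  apply: leq_trans le0; apply: (@leq_trans (m * (4 * e ^ 2 * #|F|.-1))).
    by rewrite ltn_pmul2l.
  rewrite mulnA mulnC leq_pmul2l //.
  case: m m0 {IH leA A0 jm} => // m _.
  rewrite [4 * _.+1]mulnS expnD (mulnC m.+1).
  apply: leq_mul.
    by rewrite (expnM e 2 2) -[leqRHS]mulnn leq_mul2r (@leq_sqr 2) e1 orbT.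
  rewrite expnM; apply: ltn_expl; rewrite -(exp1n 4) ltn_exp2r //.
have [x0 x0A x0B] : exists2 x0, x0 \in A 0 & forall j, j < m -> x0 \notin B j.
  have : ~~ (A 0 \subset \bigcup_(j < m) B j).
    apply/negP => /subset_leq_card; apply/negP; rewrite -ltnNge.
    have leU : #|\bigcup_(j < m) B j| <= \sum_(j < m) #|B j|.
      elim/big_rec2: _ => [|j s S _ leS]; first by rewrite cards0.
      by apply: leq_trans (leq_card_setU _ _).1 _; rewrite leq_add2l.
    apply: leq_ltn_trans leU _; case: (posnP m) => [->|m0].
      by rewrite big_ord0 A0.
    rewrite -(ltn_pmul2l m0) big_distrr /= -(prednK (A0 0 isT)).
    apply: (@leq_ltn_trans (\sum_(j < m) #|A 0|.-1)).
      by apply: leq_sum => j _; rewrite -ltnS prednK ?A0 // smallB.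
    by rewrite sum_nat_const card_ord ltn_pmul2l.
  case/subsetPn => x0 x0A x0U; exists x0 => // j jm; apply: contra x0U => xB.
  by apply/bigcupP; exists (Ordinal jm).
pose A' i := [set y in A i.+1 | (y - x0) ^+ f == w 0 i.+1]%R.
have [i j|i im|x [xA xw]] := IH A' (fun i j => w i.+1 j.+1).
- exact: we.
- have := x0B i im; rewrite inE -ltnNge -/(A' i) => ltA.
  (* As 2 <= e, the loss 2 * e is at most e ^ 2, so one choice costs a factor e ^ 4 in the squared
     size. One unit of m in the exponent [4 * m.-1] pays for it. *)
  have le1 : #|A i.+1| <= e ^ 2 * #|A' i|.
    apply: leq_trans (ltnW ltA) _; rewrite leq_mul2r -[e ^ 2]mulnn.
    by rewrite leq_mul2r e1 !orbT.
  have e40 : 0 < e ^ 4 by rewrite expn_gt0 ltnW.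
  rewrite -(leq_pmul2r e40) -mulnA -expnD.
  have -> : 4 * m.-1 + 4 = 4 * m.
    by case: m im {IH leA A0 smallB x0B} => // m; lia.
  apply: leq_trans (leA i.+1 im) _.
  by rewrite mulnC (expnM e 2 2) -expnMn leq_sqr.
exists (fun i => if i is i'.+1 then x i' else x0); split=> [[|i] //= im|].
  by have := xA i im; rewrite inE => /andP[].
case=> [|i] [|j] //= ijm; last exact: xw.
by have := xA j ijm; rewrite inE => /andP[_ /eqP].
Qed.

Lemma cyclotomic_tuple (F : finFieldType) (e f k : nat) (w : nat -> nat -> F) :
  e * f = #|F|.-1 -> 1 < k -> e ^ (k * (k - 1)) < #|F| ->
  (e = 1 -> k <= #|F|) -> (forall i j, (w i j ^+ e = 1)%R) ->
  exists x : nat -> F, forall i j, i < j < k -> ((x j - x i) ^+ f = w i j)%R.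
Proof.
move=> ef k1 ltF le_k we; have F1 := finNzRing_gt1 F.
have Q0 : 0 < #|F|.-1 by rewrite -subn1 subn_gt0.
have [e0 f0] : 0 < e /\ 0 < f by apply/andP; rewrite -muln_gt0 ef.
have [e1|e1] := leqP e 1.
  have {}e1 : e = 1 by apply/eqP; rewrite eqn_leq e1.
  (* For e = 1 the only class consists of all nonzero elements, so k distinct points suffice; this
     is where k <= #|F| enters. *)
  exists (fun i => nth 0%R (enum F) i) => i j /andP[ij jk].
  have jF : j < #|F| := leq_trans jk (le_k e1).
  have := we i j; rewrite e1 expr1 => ->.
  have nz : (nth 0 (enum F) j - nth 0 (enum F) i != 0)%R.
    rewrite subr_eq0 nth_uniq ?enum_uniq -?cardE //; last exact: ltn_trans jF.
    by rewrite gtn_eqF.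
  by rewrite -[f]mul1n -e1 ef expf_pred_card.
case: k k1 ltF {le_k} => // k k0 ltF; rewrite subn1 /= in ltF.
have [_ cf] := card_power_fiber_roots ef.
pose A i : {set F} := [set y | y ^+ f == w 0 i.+1]%R.
have leA i : i < k -> #|F|.-1 * e ^ (4 * k.-1) <= #|A i| ^ 2.
  move=> ik; have sqr_e : 0 < e ^ 2 by rewrite expn_gt0 e0.
  rewrite /A cf // -(leq_pmul2l sqr_e) -expnMn ef.
  rewrite mulnCA -expnD -[leqRHS]mulnn leq_pmul2l //.
  rewrite -ltnS prednK ?(ltnW F1) //; apply: leq_ltn_trans ltF.
  (* The exponents satisfy 2 + 4 (k - 1) <= k (k + 1), since the difference is (k - 1) (k - 2). Here
     [k] is one less than the number of points. *)
  by rewrite leq_pexp2l //; case: k k0 {A ik w we} => [|[|[|k]]] // _; nia.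
have [x [xA xw]] :=
  cyclotomic_embedding ef e1 (fun i j => we i.+1 j.+1) leA.
(* The first point is normalised to 0, so that each other point starts from a single cyclotomic
   class, of size f. *)
exists (fun i => if i is i'.+1 then x i' else 0%R).
case=> [|i] [|j] //= ijk; last exact: xw.
by have := xA j ijk; rewrite subr0 inE => /eqP.
Qed.

(** * Separating the columns of a difference matrix by cyclotomic classes *)

(** The columns with a given difference in rows i <> j are as many as the e-th roots of unity, so
    [W] matches them bijectively with these roots. [cyclotomic_tuple] then realises, column by
    column, the classes for all pairs of rows at once. *)
Lemma difference_matrix_separated (F : finFieldType) (e f k : nat)
    (G : finZmodType) (C : finType) (D : 'I_k -> C -> G) :
  difference_matrix e D -> e * f = #|F|.-1 -> 1 < k ->
  e ^ (k * (k - 1)) < #|F| -> (e = 1 -> k <= #|F|) ->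
  exists x : C -> 'I_k -> F,
    (forall c i j, i != j -> x c i != x c j) /\
    (forall (i j : 'I_k) (g : G) (z : F), i != j -> z != 0%R ->
      exists! c, (D i c - D j c)%R = g /\ ((x c i - x c j) ^+ f = z ^+ f)%R).
Proof.
case: k D => // k D dm ef k1 ltF le_k.
have [cR cf] := card_power_fiber_roots ef; have F1 := finNzRing_gt1 F.
set R := [set w | _] in cR.
have f0 : 0 < f.
  by move: F1; rewrite -subn_gt0 subn1 -ef muln_gt0 => /andP[].
have e0 : 0 < e.
  by move: F1; rewrite -subn_gt0 subn1 -ef muln_gt0 => /andP[].
pose fib (i j : 'I_k.+1) c := [set c' | D i c' - D j c' == D i c - D j c]%R.
pose W i j c : F := nth 1%R (enum R) (index c (enum (fib i j c))).
have We i j c : (W i j c ^+ e = 1)%R.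
  (* For i = j the fibre contains all columns and the index may run past the list of roots; the
     default 1 is a root as well. *)
  have [lt|ge] := ltnP (index c (enum (fib i j c))) (size (enum R)).
    by have := mem_nth 1%R lt; rewrite -/(W i j c) mem_enum inE => /eqP.
  by rewrite /W nth_default // expr1n.
have /fin_all_exists [x0 x0W] : forall c, exists x : nat -> F, forall i j,
    i < j < k.+1 -> ((x j - x i) ^+ f = W (inord i) (inord j) c)%R.
  by move=> c; apply: cyclotomic_tuple ef k1 ltF le_k _ => i j; exact: We.
pose x c (i : 'I_k.+1) := x0 c i.
have xW c (i j : 'I_k.+1) : i < j -> ((x c j - x c i) ^+ f = W i j c)%R.
  by move=> ij; rewrite x0W ?ij //= !inord_val.
have root_neq0 z : (z ^+ e = 1 -> z != 0 :> F)%R.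
  move/eqP; apply: contraTneq => ->.
  by rewrite expr0n gtn_eqF // eq_sym oner_eq0.
have x_neq c i j : i != j -> x c i != x c j.
  wlog ij : i j / i < j => [wl|_].
    rewrite neq_ltn => /orP[] ij; [|rewrite eq_sym]; apply: wl;
      by rewrite ?neq_ltn ?ij.
  rewrite eq_sym -subr_eq0; have := root_neq0 _ (We i j c).
  by rewrite -xW // expf_eq0 f0.
have x_inj i j c c' : i != j -> (D i c - D j c = D i c' - D j c')%R ->
    ((x c i - x c j) ^+ f = (x c' i - x c' j) ^+ f)%R -> c = c'.
  wlog ij : i j / i < j => [wl|_ Dc].
    rewrite neq_ltn => /orP[] ij; first by apply: wl; rewrite // neq_ltn ij.
    move=> Dc xc; apply: (wl j i) => //; first by rewrite neq_ltn ij.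
      by rewrite -opprB Dc opprB.
    by rewrite -opprB exprNn xc -exprNn opprB.
  (* [W] governs the differences x_j - x_i with i < j. Reversing them multiplies by the constant
     (-1) ^+ f, which does not affect injectivity. *)
  have xN b : ((x b i - x b j) ^+ f = (-1) ^+ f * W i j b)%R.
    by rewrite -opprB [LHS]exprNn xW.
  rewrite !xN => /(mulfI _) eqW.
  have {}eqW : W i j c = W i j c'.
    by apply: eqW; rewrite expf_neq0 // oppr_eq0 oner_eq0.
  have fibc : fib i j c' = fib i j c by apply/setP => b; rewrite !inE Dc.
  have c_fib : c \in enum (fib i j c) by rewrite mem_enum inE.
  have c'_fib : c' \in enum (fib i j c) by rewrite -fibc mem_enum inE.
  have size_fib : size (enum (fib i j c)) = size (enum R).
    by rewrite -!cardE cR dm // neq_ltn ij.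
  move/eqP: eqW; rewrite /W fibc.
  rewrite nth_uniq ?enum_uniq -?size_fib ?index_mem // => /eqP eq_index.
  by rewrite -(nth_index c c_fib) eq_index nth_index.
exists x; split=> // i j g z ij z0.
pose phi c := ((x c i - x c j) ^+ f)%R.
set S := [set c | (D i c - D j c)%R == g].
(* [phi] is injective on [S] by [x_inj], and both sets have e elements. Surjectivity gives the
   existence of the column, [x_inj] its uniqueness. *)
have phiS : phi @: S = R.
  apply/eqP; rewrite eqEcard; apply/andP; split.
    apply/subsetP => _ /imsetP[c _ ->].
    by rewrite inE -exprM mulnC ef expf_pred_card // subr_eq0 x_neq.
  rewrite card_in_imset ?cR ?dm // => c c'; rewrite !inE => /eqP<- /eqP Dc.
  by apply: x_inj.
have : (z ^+ f)%R \in phi @: S.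
  by rewrite phiS inE -exprM mulnC ef expf_pred_card.
case/imsetP => c; rewrite inE => /eqP Dc zc; exists c; split=> // c' [Dc' zc'].
by apply: (x_inj i j); rewrite ?Dc ?zc'.
Qed.

(** * The holey transversal design on G x F *)

Lemma snd_hole_partition (S T : finType) (s0 : S)
    (H := [set [set x : S * T | x.2 == y] | y : T]) :
  hole_partition #|S| #|T| H /\ forall x y, same_hole H x y = (x.2 == y.2).
Proof.
pose fiber (y : T) := [set x : S * T | x.2 == y].
have fiber_inj : injective fiber.
  by move=> y y' /setP/(_ (s0, y)); rewrite !inE eqxx => /esym/eqP.
split=> [|x y]; last first.
  apply/exists_inP/eqP => [[_ /imsetP[z _ ->]]|xy].
    by rewrite !inE => /andP[/eqP -> /eqP ->].
  by exists (fiber x.2); rewrite ?imset_f // !inE xy eqxx.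
apply/and3P; split.
- have -> : [set: S * T] = cover H.
    apply/setP => x; rewrite inE; apply/esym/bigcupP.
    by exists (fiber x.2); rewrite ?imset_f // inE.
  have [||//] := @indexed_partition T (S * T)%type predT fiber.
    move=> y y' _ _ yy'; rewrite -setI_eq0; apply/eqP/setP => x.
    by rewrite !inE; apply: contra_neqF yy' => /andP[/eqP-> /eqP].
  by move=> y _; apply/set0Pn; exists (s0, y); rewrite inE.
- by rewrite /H (card_imset _ fiber_inj).
- apply/forall_inP => _ /imsetP[y _ ->].
  have -> : [set x : S * T | x.2 == y] = setX [set: S] [set y].
    by apply/setP => x; rewrite !inE.
  by rewrite cardsX cards1 muln1 cardsT.
Qed.

Lemma HTD_exists_difference_matrix (h k e q : nat) :
  1 < k -> 0 < h -> difference_matrix_exists k h e -> prime_power q ->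
  q = 1 %[mod e] -> e ^ (k * (k - 1)) < q -> (e = 1 -> k <= q) ->
  HTD_exists k h q.
Proof.
move=> k1 h0 [G [C [D [cG dm]]]] [p [a [pp a0 qE]]] q1 ltq le_k.
have [F pF cF] := pPrimePowerField pp a0; rewrite -qE in cF.
have F1 := finNzRing_gt1 F.
have [f fe] : exists f, e * f = #|F|.-1.
  have /dvdnP[f fe] : e %| q - 1 by rewrite -eqn_mod_dvd ?q1 // -cF ltnW.
  by exists f; rewrite mulnC -fe cF subn1.
rewrite -cF in ltq le_k *.
have [x [x_neq x_sep]] := difference_matrix_separated dm fe k1 ltq le_k.
pose U := [set u : F | u ^+ f == 1]%R.
have U0 u : u \in U -> u != 0%R.
  rewrite inE; apply: contraTneq => ->.
  rewrite expr0n gtn_eqF 1?eq_sym ?oner_eq0 //.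
  by move: F1; rewrite -subn_gt0 subn1 -fe muln_gt0 => /andP[].
pose pt (t : C * F * G * F) i := let: (c, u, g, y) := t in
  (i, (D i c + g, u * x c i + y)%R).
pose block t := [set pt t i | i : 'I_k].
have pt_in t i v : ((i, v) \in block t) = (pt t i == (i, v)).
  apply/imsetP/eqP => [[j _]|<-]; last by exists i.
  by case: t => [[[c u] g] y] /= [-> ->].
have [HP HS] := snd_hole_partition F (0 : G)%R.
exists (G * F)%type, [set [set x : G * F | x.2 == y] | y : F],
  [set block t | t in [set t : C * F * G * F | t.1.1.2 \in U]].
split.
- by rewrite card_prod cG.
- by rewrite -cG.
- move=> _ /imsetP[t _ ->]; rewrite card_imset ?card_ord //.
  by move=> i j; case: t => [[[c u] g] y] [].
- move=> i j [g1 y1] [g2 y2] ij; rewrite HS /= => y12.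
  have z0 : (y1 - y2 != 0)%R by rewrite subr_eq0.
  (* The differences g1 - g2 and y1 - y2 determine the column c. The quotient u lies in [U] since
     its numerator and denominator have equal f-th powers, and the point in row i forces the
     translation. *)
  have [c [[Dc xc] c_uniq]] := x_sep i j (g1 - g2)%R _ ij z0.
  have xij0 c' : (x c' i - x c' j != 0)%R by rewrite subr_eq0 x_neq.
  pose u := ((y1 - y2) / (x c i - x c j))%R.
  pose t := (c, u, g1 - D i c, y1 - u * x c i)%R.
  apply/eqP/cards1P; exists (block t); apply/setP => b; rewrite !inE.
  apply/andP/eqP => [[/imsetP[[[[c' u'] g'] y']]]|->].
    rewrite inE /= => u'U ->; rewrite !pt_in.
    move=> /andP[/eqP[Dg1 xy1] /eqP[Dg2 xy2]].
    have cc' : c = c'.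
      apply: c_uniq; split.
        by rewrite -Dg1 -Dg2 opprD addrACA subrr addr0.
      have -> : (y1 - y2 = u' * (x c' i - x c' j))%R by rewrite -xy1 -xy2; ring.
      by move: u'U; rewrite inE exprMn => /eqP ->; rewrite mul1r.
    congr (block _); rewrite /t cc' -Dg1 -xy1.
    have -> : u = u'.
      rewrite /u cc'; apply: (canLR (mulfK _)); rewrite ?xij0 //.
      by rewrite -xy1 -xy2; ring.
    by congr (_, _, _, _); rewrite addrC addKr.
  split.
    apply/imsetP; exists t => //; rewrite !inE /= expr_div_n -xc divff //.
    by rewrite expf_neq0.
  rewrite !pt_in /=; apply/andP; split; apply/eqP; congr (_, (_, _)).
  + by rewrite addrC subrK.
  + by rewrite addrC subrK.
  + by move/(congr1 (fun g => g1 - g)%R): Dc; rewrite subKr opprB addrCA.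
  + have : (u * (x c i - x c j) = y1 - y2)%R by rewrite /u mulfVK.
    by move/(congr1 (fun y => y1 - y)%R); rewrite subKr => <-; ring.
- move=> _ /imsetP[[[[c u] g] y] + ->]; rewrite inE /= => uU.
  move=> _ _ /imsetP[i _ ->] /imsetP[j _ ->] ij /=.
  have {}ij : i != j by apply: contraNneq ij => ->.
  rewrite HS /= => -[/eqP|]; first by rewrite (negPf ij).
  (* Two points in one hole would give u x_ci = u x_cj with u nonzero, although the x_ci are
     distinct for fixed c. *)
  move/eqP/addIr/mulfI => /(_ (U0 u uU))/eqP.
  by rewrite (negPf (x_neq _ _ _ ij)).
Qed.

(** * From holey transversal designs to orthogonal holey latin squares *)

Lemma same_hole_refl (h n : nat) (X : finType) (H : {set {set X}}) (x : X) :
  hole_partition h n H -> same_hole H x x.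
Proof.
case/and3P => pH _ _; apply/exists_inP.
have xH : x \in cover H by rewrite (cover_partition pH) inE.
by exists (pblock H x); rewrite ?pblock_mem // mem_pblock xH.
Qed.

Lemma exists_different_holes (h n : nat) (X : finType) (H : {set {set X}}) :
  0 < h -> 1 < n -> hole_partition h n H -> exists x y, ~~ same_hole H x y.
Proof.
move=> h0 n1 /and3P[pH /eqP nH /forall_inP hH].
have /card_gt1P[A [C [AH CH AC]]] : 1 < #|H| by rewrite nH.
have /card_gt0P[x xA] : 0 < #|A| by rewrite (eqP (hH _ AH)).
have /card_gt0P[y yC] : 0 < #|C| by rewrite (eqP (hH _ CH)).
exists x, y; apply: contra AC => /exists_inP[D DH /andP[xD yD]].
have tH := partition_trivIset pH.
by rewrite -(def_pblock tH AH xA) (def_pblock tH DH xD)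
  -(def_pblock tH DH yD) (def_pblock tH CH yC).
Qed.

Lemma hole_partition_imset (h n : nat) (X Y : finType) (H : {set {set X}})
    (phi : X -> Y) (psi : Y -> X) (H' := [set phi @: (A : {set X}) | A in H]) :
  cancel phi psi -> cancel psi phi -> hole_partition h n H ->
  hole_partition h n H' /\
  forall s t, same_hole H' s t = same_hole H (psi s) (psi t).
Proof.
move=> phiK psiK /and3P[pH nH hH]; have phi_inj := can_inj phiK.
have mem_phi s (A : {set X}) : (s \in phi @: A) = (psi s \in A).
  by rewrite -{1}(psiK s) mem_imset.
split=> [|s t].
  apply/and3P; split.
  - have -> : [set: Y] = phi @: [set: X].
      by apply/setP => s; rewrite mem_phi !inE.
    by rewrite imset_partition.
  - by rewrite card_imset //; apply: imset_inj.
  - apply/forall_inP => _ /imsetP[A AH ->]; rewrite card_imset //.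
    exact: (forall_inP hH).
apply/exists_inP/exists_inP => [[_ /imsetP[A AH ->]]|[A AH stA]].
  by rewrite !mem_phi; exists A.
by exists (phi @: A); rewrite ?imset_f // !mem_phi.
Qed.

(** The last two groups, [r] and [c], index rows and columns. Each remaining group s gives a square,
    whose entry in cell (i, j) is the point of group s on the block through row i and column j. *)
Lemma leq_N_HMOLS_HTD (k h n : nat) :
  0 < h -> 1 < n -> HTD_exists (k + 2) h n -> k <= N_HMOLS h n.
Proof.
move=> h0 n1 [X [H [B [cX pH cB pairB holeB]]]].
have block_ex i j x y : i != j -> ~~ same_hole H x y ->
    exists2 b, b \in B & ((i, x) \in b) && ((j, y) \in b).
  move=> ij xy; have /eqP/cards1P[b /setP/(_ b)] := pairB i j x y ij xy.
  by rewrite !inE eqxx => /andP[bB b_ij]; exists b.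
have block_diff b i j x y : b \in B -> i != j -> (i, x) \in b -> (j, y) \in b ->
    ~~ same_hole H x y.
  move=> bB ij xb yb; apply/negP => xy.
  have /(_ _ _ xb yb) := holeB b bB; apply; last by right.
  by apply: contraNneq ij => -[->].
have block_uniq b b' i j x y : b \in B -> b' \in B -> i != j ->
    (i, x) \in b -> (j, y) \in b -> (i, x) \in b' -> (j, y) \in b' -> b = b'.
  move=> bB b'B ij xb yb xb' yb'; have xy := block_diff b i j x y bB ij xb yb.
  have /eqP/cards1P[b0 /setP b0P] := pairB i j x y ij xy.
  have := b0P b; have := b0P b'; rewrite !inE bB b'B xb yb xb' yb' /=.
  by move=> /esym/eqP -> /esym/eqP ->.
have pt_uniq b i x y : b \in B -> (i, x) \in b -> (i, y) \in b -> x = y.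
  move=> bB xb yb; apply: contraPeq (holeB b bB _ _ xb yb) => xy; apply.
    by apply: contra_neq xy => -[->].
  by left.
have pt_ex b i : b \in B -> exists x, (i, x) \in b.
  move=> bB; have fst_inj : {in b &, injective (@fst 'I_(k + 2) X)}.
    by move=> [j x] [j' y] xb yb /= jj'; subst j'; rewrite (pt_uniq b j x y bB).
  have : i \in fst @: b.
    suff -> : fst @: b = [set: 'I_(k + 2)] by rewrite inE.
    apply/eqP; rewrite eqEcard subsetT cardsT card_ord.
    by rewrite (card_in_imset fst_inj) cB ?leqnn.
  by case/imsetP => -[j x] xb /= ->; exists x.
(* The points and holes are transported along an enumeration, since squares are indexed by
   ordinals. *)
pose phi (x : X) : 'I_(h * n) := cast_ord cX (enum_rank x).
pose psi (s : 'I_(h * n)) : X := enum_val (cast_ord (esym cX) s).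
have phiK : cancel phi psi by move=> x; rewrite /psi cast_ordK enum_rankK.
have psiK : cancel psi phi by move=> x; rewrite /phi enum_valK cast_ordKV.
have [pH'] := hole_partition_imset phiK psiK pH.
set H' := [set _ | _ in _]; move=> sameE.
pose r : 'I_(k + 2) := rshift k (ord0 : 'I_2).
pose c : 'I_(k + 2) := rshift k (ord_max : 'I_2).
have rc : r != c by rewrite eq_rshift.
have sr (s : 'I_k) : lshift 2 s != r by rewrite eq_lrshift.
have sc (s : 'I_k) : lshift 2 s != c by rewrite eq_lrshift.
pose inc s i j t := [exists b in B,
  [&& (r, psi i) \in b, (c, psi j) \in b & (lshift 2 s, psi t) \in b]].
pose L s : square (h * n) := (\matrix_(i, j) [pick t | inc s i j t])%R.
have LE s i j t : (L s i j == Some t) = inc s i j t.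
  rewrite mxE; case: pickP => [t' t'P|->] //; apply/eqP/idP => [[<-] //|].
  case/exists_inP=> b bB /and3P[ib jb tb].
  move: t'P => /exists_inP[b' b'B /and3P[ib' jb' tb']].
  move: tb'; rewrite -(block_uniq b b' r c _ _ bB b'B rc ib jb ib' jb') => tb'.
  by congr Some; apply: (can_inj psiK); by rewrite (pt_uniq b _ _ _ bB tb' tb).
have LH s : holey_latin H' (L s).
  apply/and4P; split.
  - apply/forallP => i; apply/forallP => j; rewrite sameE; apply/eqP.
    apply/idP/idP => [/eqP Lij|ij].
      have [//|ij] := boolP (same_hole H (psi i) (psi j)).
      have [b bB /andP[ib jb]] := block_ex r c _ _ rc ij.
      have [x xb] := pt_ex b (lshift 2 s) bB.
      have : L s i j == Some (phi x).
        by rewrite LE; apply/exists_inP; exists b; rewrite // phiK ib jb xb.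
      by rewrite Lij.
    case Lij: (L s i j) => [t|] //; move/eqP: Lij; rewrite LE.
    case/exists_inP => b bB /and3P[ib jb _].
    by have := block_diff b _ _ _ _ bB rc ib jb; rewrite ij.
  - apply/forallP => i; apply/forallP => t; apply/card_le1_eqP => j j'.
    rewrite !inE !LE => /exists_inP[b bB /and3P[ib jb tb]].
    move=> /exists_inP[b' b'B /and3P[ib' jb' tb']]; apply: (can_inj psiK).
    rewrite -(block_uniq b b' _ _ _ _ bB b'B (sr s) tb ib tb' ib') in jb'.
    by rewrite (pt_uniq b _ _ _ bB jb jb').
  - apply/forallP => j; apply/forallP => t; apply/card_le1_eqP => i i'.
    rewrite !inE !LE => /exists_inP[b bB /and3P[ib jb tb]].
    move=> /exists_inP[b' b'B /and3P[ib' jb' tb']]; apply: (can_inj psiK).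
    rewrite -(block_uniq b b' _ _ _ _ bB b'B (sc s) tb jb tb' jb') in ib'.
    by rewrite (pt_uniq b _ _ _ bB ib ib').
  - apply/forallP => i; apply/forallP => j; apply/forallP => t; apply/implyP.
    rewrite LE !sameE => /exists_inP[b bB /and3P[ib jb tb]].
    by rewrite (block_diff b _ _ _ _ bB (sr s) tb ib)
      (block_diff b _ _ _ _ bB (sc s) tb jb).
have Lorth s s' : s != s' -> orthogonal_holey H' (L s) (L s').
  move=> ss'; have lss' : lshift 2 s != lshift 2 s' by rewrite eq_lshift.
  apply/forallP => t; apply/forallP => t'; apply/implyP; rewrite sameE => tt'.
  have [b bB /andP[tb tb']] := block_ex _ _ _ _ lss' tt'.
  have [x xb] := pt_ex b r bB; have [y yb] := pt_ex b c bB.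
  apply/cards1P; exists (phi x, phi y); apply/setP => -[i j].
  rewrite !inE !LE /=.
  apply/andP/eqP => [[]|[-> ->]]; last first.
    by split; apply/exists_inP; exists b; rewrite // !phiK xb yb ?tb ?tb'.
  move=> /exists_inP[b1 b1B /and3P[ib1 jb1 tb1]].
  move=> /exists_inP[b2 b2B /and3P[ib2 jb2 tb2]].
  have b12 := block_uniq b1 b2 _ _ _ _ b1B b2B rc ib1 jb1 ib2 jb2.
  rewrite -b12 in tb2.
  have bb1 := block_uniq b b1 _ _ _ _ bB b1B lss' tb tb' tb1 tb2.
  rewrite -bb1 in ib1 jb1.
  by rewrite (pt_uniq b r _ _ bB xb ib1) (pt_uniq b c _ _ bB yb jb1) !psiK.
(* [N_HMOLS] counts a set, so the squares must be distinct. If two agreed, the block of a filled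
   cell, which exists as there are at least two nonempty holes, would contain the same x in two
   groups. *)
have L_inj : injective L.
  move=> s s' Lss'; apply/eqP/negPn/negP => ss'.
  have [x [y xy]] := exists_different_holes h0 n1 pH'.
  have lss' : lshift 2 s != lshift 2 s' by rewrite eq_lshift.
  move: xy; have /and4P[/forallP/(_ x)/forallP/(_ y)/eqP <- _ _ _] := LH s.
  case Lxy: (L s x y) => [t|] // _.
  move: (Lxy) => /eqP; rewrite LE => /exists_inP[b bB /and3P[ib jb tb]].
  rewrite Lss' in Lxy; move/eqP: Lxy; rewrite LE.
  move=> /exists_inP[b' b'B /and3P[ib' jb' tb']].
  rewrite -(block_uniq b b' _ _ _ _ bB b'B rc ib jb ib' jb') in tb'.
  by have := block_diff b _ _ _ _ bB lss' tb tb'; rewrite (same_hole_refl _ pH).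
rewrite -[leqLHS]card_ord -[leqLHS](card_imset _ L_inj) /N_HMOLS.
apply: (@leq_bigmax_cond _ _ (fun S : {set square (h * n)} => #|S|)).
apply/existsP; exists H'; apply/and3P; split=> //.
  by apply/forall_inP => _ /imsetP[s _ ->].
apply/forall_inP => _ /imsetP[s _ ->]; apply/forall_inP => _ /imsetP[s' _ ->].
by apply/implyP => Lss'; apply: Lorth; apply: contra_neq Lss' => ->.
Qed.

Theorem theorem2p6 (h k : nat) (hh : 2 <= h) (hk : 2 <= k) :
  (forall q : nat, prime_power q -> q = 1 %[mod lambda h k] ->
     lambda h k ^ (k * (k - 1)) < q ->
     (lambda h k = 1 -> k <= q) ->
     HTD_exists k h q)
  /\
  (forall q : nat, prime_power q -> q = 1 %[mod lambda h (k + 2)] ->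
     lambda h (k + 2) ^ ((k + 2) * (k + 1)) < q ->
     (lambda h (k + 2) = 1 -> k + 2 <= q) ->
     k <= N_HMOLS h q).
Proof.
have h0 : 0 < h by apply: ltnW.
split=> q q_pp q1 ltq le_q.
  exact: (HTD_exists_difference_matrix hk h0
    (difference_matrix_exists_lambda h0 hk)).
have q2 : 1 < q.
  case: q_pp => p [a [pp a0 ->]]; rewrite -(exp1n a) ltn_exp2r //.
  exact: prime_gt1.
have k2 : 1 < k + 2 by rewrite addn2.
apply: leq_N_HMOLS_HTD => //.
apply: (HTD_exists_difference_matrix k2 h0
  (difference_matrix_exists_lambda h0 k2)) => //.
by rewrite -addnBA.
Qed.
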